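(* Let $\mathcal{H}$ be a complex Hilbert space, let $A\in\mathbb{B}(\mathcal{H})$ be a positive operator, and let $\mathbb{A}=\begin{bmatrix} A & 0\\ 0 & A\end{bmatrix}$ on $\mathcal{H}\oplus\mathcal{H}$. Let $X\in\mathbb{B}_{A^{1/2}}(\mathcal{H})$. Then $$w_{\mathbb{A}}\left(\begin{bmatrix} 0 & X \\ 0 & 0 \end{bmatrix}\right) = w_{\mathbb{A}}\left(\begin{bmatrix} 0 & 0 \\ X & 0 \end{bmatrix}\right)=\frac{1}{2}\|X\|_{A}.$$
   Context: $\mathbb{B}(\mathcal{H})$ is the algebra of bounded linear operators on the complex Hilbert space $\mathcal{H}$. A positive operator $A$ (i.e. $\langle Ax,x\rangle\ge 0$ for all $x$) induces the semi-inner product $\langle x,y\rangle_A=\langle Ax,y\rangle$ and the seminorm $\|x\|_A=\sqrt{\langle x,x\rangle_A}$. $\mathbb{B}_{A^{1/2}}(\mathcal{H})=\{T\in\mathbb{B}(\mathcal{H}): \exists c>0,\ \|Tx\|_A\le c\|x\|_A\ \forall x\in\mathcal{H}\}$. For $T\in\mathbb{B}_{A^{1/2}}(\mathcal{H})$ the $A$-operator seminorm is $\|T\|_A=\sup\{\|Tx\|_A: x\in\mathcal{H},\ \|x\|_A=1\}$ and the $A$-numerical radius is $w_A(T)=\sup\{|\langle Tx,x\rangle_A|: x\in\mathcal{H},\ \|x\|_A=1\}$. The same definitions with $\mathcal{H}\oplus\mathcal{H}$ and $\mathbb{A}$ in place of $\mathcal{H}$ and $A$ give $\langle\cdot,\cdot\rangle_{\mathbb{A}}$,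 $\|\cdot\|_{\mathbb{A}}$ and $w_{\mathbb{A}}(\cdot)$, where $\langle x,y\rangle_{\mathbb{A}}=\langle x_1,y_1\rangle_A+\langle x_2,y_2\rangle_A$ for $x=(x_1,x_2)$, $y=(y_1,y_2)$. $2\times2$ block matrices of operators on $\mathcal{H}$ act on $\mathcal{H}\oplus\mathcal{H}$ in the usual way. *)

(* Defs.v *)
From HB Require Import structures.
From mathcomp Require Import all_boot all_order all_algebra sesquilinear.
From mathcomp Require Import complex ring.
From mathcomp Require Import boolp classical_sets reals.
From mathcomp Require Import topology normedtype.

Set Implicit Arguments.
Unset Strict Implicit.
Unset Printing Implicit Defensive.

Import Order.TTheory GRing.Theory Num.Theory.
Import numFieldNormedType.Exports.

Local Open Scope classical_set_scope.
Local Open Scope ring_scope.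

HB.mixin Record CompleteNormedModule_isHilbert (R : realType) H
    & CompleteNormedModule R[i] H := {
  inner : {dot H for @Num.conj R[i]} ;
  norm_inner : forall x : H, `|x| = sqrtC (inner x x)
}.

#[short(type="hilbertType")]
HB.structure Definition Hilbert (R : realType) :=
  {H of CompleteNormedModule R[i] H & CompleteNormedModule_isHilbert R H}.

Arguments inner {R s}.

(* An alias of the product, so that H (+) H carries its Hilbert norm rather than
   the maximum norm of the product normed module. *)
Definition hsum (H : Type) : Type := (H * H)%type.

Section HilbertSum.
Context {R : realType} {H : hilbertType R}.

HB.instance Definition _ := GRing.Lmodule.copy (hsum H) (H * H)%type.

Definition hsum_inner (x y : hsum H) : R[i] :=
  inner x.1 y.1 + inner x.2 y.2.

Lemma hsum_inner_linearl (y : hsum H) :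
  linear_for *%R (fun x : hsum H => hsum_inner x y).
Proof.
move=> a x z; rewrite /hsum_inner /=.
by rewrite !linearPl /= mulrDr addrACA.
Qed.

Lemma hsum_inner_linearr (x : hsum H) :
  linear_for (@Num.conj R[i] \; *%R) (hsum_inner x).
Proof.
move=> a y z; rewrite /hsum_inner /=.
by rewrite !linearPr /= mulrDr addrACA.
Qed.

HB.instance Definition _ := @bilinear_isBilinear.Build R[i] (hsum H) (hsum H)
  R[i] *%R (@Num.conj R[i] \; *%R) hsum_inner
  (conj hsum_inner_linearl hsum_inner_linearr).

Lemma hsum_inner_herm (x y : hsum H) :
  hsum_inner x y = (-1) ^+ false * Num.conj (hsum_inner y x).
Proof. by rewrite /hsum_inner !(hermC inner x.1, hermC inner x.2) !mul1r rmorphD. Qed.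

HB.instance Definition _ := @isHermitianSesquilinear.Build R[i] (hsum H) false
  (@Num.conj R[i]) hsum_inner hsum_inner_herm.

Lemma hsum_inner_gt0 (u : hsum H) : u != 0 -> 0 < hsum_inner u u.
Proof.
case: u => u v; rewrite -[(u, v) == 0]/((u == 0) && (v == 0)) negb_and.
rewrite /hsum_inner /= => /orP[] h.
  by rewrite ltr_pwDl ?dnorm_ge0 ?dnorm_gt0.
by rewrite ltr_wpDl ?dnorm_ge0 ?dnorm_gt0.
Qed.

HB.instance Definition _ := @isDotProduct.Build R[i] (hsum H) hsum_inner
  hsum_inner_gt0.

Definition hsum_norm (x : hsum H) : R[i] := sqrtC (hsum_inner x x).

Lemma hsum_normE (x : hsum H) : hsum_norm x = sqrtC (`|x.1| ^+ 2 + `|x.2| ^+ 2).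
Proof. by rewrite /hsum_norm /hsum_inner !norm_inner !sqrtCK. Qed.

Let sqrtC_sum (a b : R[i]) : 0 <= a -> 0 <= b -> 0 <= sqrtC (a ^+ 2 + b ^+ 2).
Proof. by move=> a0 b0; rewrite sqrtC_ge0 addr_ge0 ?exprn_ge0. Qed.

Let minkowski2 (a b c d : R[i]) : 0 <= a -> 0 <= b -> 0 <= c -> 0 <= d ->
  sqrtC ((a + c) ^+ 2 + (b + d) ^+ 2)
  <= sqrtC (a ^+ 2 + b ^+ 2) + sqrtC (c ^+ 2 + d ^+ 2).
Proof.
move=> a0 b0 c0 d0.
rewrite -ler_sqr ?nnegrE ?addr_ge0 ?sqrtC_sum ?addr_ge0//.
rewrite sqrtCK [leRHS]sqrrD !sqrtCK -sqrtCM ?nnegrE ?addr_ge0 ?exprn_ge0//.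
have h : a * c + b * d <= sqrtC ((a ^+ 2 + b ^+ 2) * (c ^+ 2 + d ^+ 2)).
  rewrite -ler_sqr ?nnegrE ?addr_ge0 ?mulr_ge0 ?sqrtC_ge0//; last first.
    by rewrite mulr_ge0 ?addr_ge0 ?exprn_ge0.
  rewrite sqrtCK -subr_ge0.
  have -> : (a ^+ 2 + b ^+ 2) * (c ^+ 2 + d ^+ 2) - (a * c + b * d) ^+ 2
    = (a * d - b * c) ^+ 2 by ring.
  by rewrite real_exprn_even_ge0// realB ?ger0_real ?mulr_ge0.
rewrite -subr_ge0; move: h; rewrite -subr_ge0; set s := sqrtC _ => h.
have -> : a ^+ 2 + b ^+ 2 + s *+ 2 + (c ^+ 2 + d ^+ 2) -
    ((a + c) ^+ 2 + (b + d) ^+ 2) = 2 * (s - (a * c + b * d)) by ring.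
by rewrite mulr_ge0.
Qed.

Lemma hsum_norm_triangle (x y : hsum H) :
  hsum_norm (x + y) <= hsum_norm x + hsum_norm y.
Proof.
rewrite !hsum_normE (le_trans _ (minkowski2 _ _ _ _))//.
rewrite ler_sqrtC ?qualifE /= ?addr_ge0 ?exprn_ge0 ?addr_ge0//.
by apply: lerD; rewrite ler_sqr ?nnegrE ?addr_ge0 ?ler_normD.
Qed.

Lemma hsum_normZ (a : R[i]) (x : hsum H) :
  hsum_norm (a *: x) = `|a| * hsum_norm x.
Proof.
rewrite !hsum_normE /= !normrZ !exprMn -mulrDr.
rewrite sqrtCM ?nnegrE ?addr_ge0 ?exprn_ge0//.
by rewrite sqrCK.
Qed.

Lemma hsum_norm_eq0 (x : hsum H) : hsum_norm x = 0 -> x = 0.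
Proof. by move=> /eqP; rewrite sqrt_dnorm_eq0 => /eqP. Qed.

HB.instance Definition _ := @Lmodule_isNormed.Build R[i] (hsum H) hsum_norm
  hsum_norm_triangle hsum_normZ hsum_norm_eq0.

Lemma hsum_norm_ge1 (x : hsum H) : `|x.1| <= `|x|.
Proof.
rewrite [leRHS]hsum_normE -ler_sqr ?nnegrE ?sqrtC_sum//.
by rewrite sqrtCK lerDl exprn_ge0.
Qed.

Lemma hsum_norm_ge2 (x : hsum H) : `|x.2| <= `|x|.
Proof.
rewrite [leRHS]hsum_normE -ler_sqr ?nnegrE ?sqrtC_sum//.
by rewrite sqrtCK lerDr exprn_ge0.
Qed.

Lemma hsum_norm_le (x : hsum H) : `|x| <= `|x.1| + `|x.2|.
Proof.
rewrite [leLHS]hsum_normE -ler_sqr ?nnegrE ?addr_ge0 ?sqrtC_sum//.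
by rewrite sqrtCK sqrrD addrAC lerDl mulrn_wge0// mulr_ge0.
Qed.

Lemma hsum_complete (F : set_system (hsum H)) :
  ProperFilter F -> cauchy F -> cvg F.
Proof.
move=> FF /cauchyP Fc.
have F1c : cauchy ((fst : hsum H -> H) @ F).
  apply/cauchyP => e e0; have [x xF] := Fc e e0; exists x.1.
  apply: (@filterS _ F _ _ _ _ xF) => y; rewrite -!ball_normE /= => xy.
  apply: le_lt_trans xy; exact: hsum_norm_ge1 (x - y).
have F2c : cauchy ((snd : hsum H -> H) @ F).
  apply/cauchyP => e e0; have [x xF] := Fc e e0; exists x.2.
  apply: (@filterS _ F _ _ _ _ xF) => y; rewrite -!ball_normE /= => xy.
  apply: le_lt_trans xy; exact: hsum_norm_ge2 (x - y).
have [a Fa] : exists a : H, (fst : hsum H -> H) @ F --> a.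
  by apply/cvg_ex; exact: (cauchy_cvg _ F1c).
have [b Fb] : exists b : H, (snd : hsum H -> H) @ F --> b.
  by apply/cvg_ex; exact: (cauchy_cvg _ F2c).
apply/cvg_ex; exists ((a, b) : hsum H).
apply/cvgrPdist_lt => e e0.
have e20 : 0 < e / 2 by rewrite divr_gt0.
move/cvgrPdist_lt : Fa => /(_ _ e20) Fa; move/cvgrPdist_lt : Fb => /(_ _ e20) Fb.
near=> y.
rewrite (le_lt_trans (hsum_norm_le _))// [ltRHS]splitr ltrD//=.
  by near: y; exact: Fa.
by near: y; exact: Fb.
Unshelve. all: by end_near. Qed.

HB.instance Definition _ := Uniform_isComplete.Build (hsum H) hsum_complete.

HB.instance Definition _ := CompleteNormedModule_isHilbert.Build R (hsum H)
  (fun x => erefl : `|x| = sqrtC (hsum_inner x x)).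

End HilbertSum.

Record boundedOp (R : realType) (H : hilbertType R) := BoundedOp {
  op_fun :> {linear H -> H} ;
  op_bounded : exists c : R[i], forall x : H, `|op_fun x| <= c * `|x|
}.

Section ZeroOp.
Context {R : realType} {H : hilbertType R}.

Lemma zero_op_bounded :
  exists c : R[i], forall x : H, `|(\0 : {linear H -> H}) x| <= c * `|x|.
Proof. by exists 0 => x; rewrite normr0 mul0r. Qed.

Definition zero_op : boundedOp H := BoundedOp zero_op_bounded.

End ZeroOp.

Section BlockOp.
Context {R : realType} {H : hilbertType R} (T11 T12 T21 T22 : boundedOp H).

Definition block_fun (x : hsum H) : hsum H :=
  (T11 x.1 + T12 x.2, T21 x.1 + T22 x.2).

Lemma block_fun_linear : linear block_fun.
Proof.
move=> a x y; rewrite /block_fun /= !linearP /=.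
by congr pair; rewrite /= scalerDr addrACA.
Qed.

HB.instance Definition _ := GRing.isLinear.Build R[i] (hsum H) (hsum H) _
  block_fun block_fun_linear.

Lemma op_bounded_nneg (T : boundedOp H) :
  exists2 c : R[i], 0 <= c & forall x : H, `|T x| <= c * `|x|.
Proof.
have [c hc] := op_bounded T.
have [T0|/existsNP[x /eqP Tx0]] := pselect (forall x, T x = 0).
  by exists 0 => // x; rewrite T0 normr0 mul0r.
have x0 : x != 0 by apply: contraNneq Tx0 => ->; rewrite linear0.
exists c => //; rewrite -(pmulr_lge0 _ (_ : 0 < `|x|)) ?normr_gt0//.
exact: le_trans (hc x).
Qed.

Lemma block_fun_bounded :
  exists c : R[i], forall x : hsum H, `|block_fun x| <= c * `|x|.
Proof.
have [a a0 ha] := op_bounded_nneg T11; have [b b0 hb] := op_bounded_nneg T12.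
have [c c0 hc] := op_bounded_nneg T21; have [d d0 hd] := op_bounded_nneg T22.
exists ((a + b) + (c + d)) => x.
rewrite (le_trans (hsum_norm_le _))// mulrDl lerD//=.
  rewrite (le_trans (ler_normD _ _))// mulrDl lerD//.
    by rewrite (le_trans (ha _))// ler_wpM2l// hsum_norm_ge1.
  by rewrite (le_trans (hb _))// ler_wpM2l// hsum_norm_ge2.
rewrite (le_trans (ler_normD _ _))// mulrDl lerD//.
  by rewrite (le_trans (hc _))// ler_wpM2l// hsum_norm_ge1.
by rewrite (le_trans (hd _))// ler_wpM2l// hsum_norm_ge2.
Qed.

Definition block_op : boundedOp (hsum H) := BoundedOp block_fun_bounded.

End BlockOp.

Section SemiHilbert.
Context {R : realType} {H : hilbertType R}.
Implicit Types A T : boundedOp H.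

(* In R[i], [0 <= z] means that z is a nonnegative real number. *)
Definition positive_op A := forall x : H, 0 <= inner (A x) x.

Definition innerA A (x y : H) : R[i] := inner (A x) y.

(* For a positive A the number [innerA A x x] is real, so that taking its real
   part only changes its type. *)
Definition normA A (x : H) : R := Num.sqrt (complex.Re (innerA A x x)).

Definition semibounded A : set (boundedOp H) :=
  [set T : boundedOp H |
    exists2 c : R, 0 < c & forall x : H, normA A (T x) <= c * normA A x].

(* [sup] is real-valued: it is the least upper bound when the set is nonempty
   and bounded above, which holds for A positive and nonzero and T in
   [semibounded A].  When A = 0 no vector has A-seminorm 1, and [sup set0 = 0]. *)
Definition opnormA A T : R :=
  sup [set normA A (T x) | x in [set x : H | normA A x = 1]].

(* The norm of a complex number has type R[i]; [complex.Re] casts it to R. *)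
Definition numradA A T : R :=
  sup [set complex.Re `|innerA A (T x) x| | x in [set x : H | normA A x = 1]].

End SemiHilbert.

Section DiagOp.
Context {R : realType} {H : hilbertType R} (A : boundedOp H).

Local Notation AA := (block_op A zero_op zero_op A).

Lemma innerA_diag (x y : hsum H) :
  innerA AA x y = innerA A x.1 y.1 + innerA A x.2 y.2.
Proof. by rewrite /innerA /= /inner/= /hsum_inner/= addr0 add0r. Qed.

Context (A0 : positive_op A).

Lemma diag_positive : positive_op AA.
Proof. by move=> x; rewrite -/(innerA _ _ _) innerA_diag addr_ge0 ?A0. Qed.

Let ReA_ge0 (x : H) : 0 <= complex.Re (innerA A x x).
Proof. by have := A0 x; rewrite lecE => /andP[]. Qed.

Lemma normA_diag (x : hsum H) :
  normA AA x = Num.sqrt (normA A x.1 ^+ 2 + normA A x.2 ^+ 2).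
Proof.
rewrite /normA innerA_diag !sqr_sqrtr ?ReA_ge0//.
by case: (innerA A x.1 x.1) (innerA A x.2 x.2) => [a b] [c d].
Qed.

Lemma normA0 : normA A 0 = 0.
Proof. by rewrite /normA /innerA linear0r sqrtr0. Qed.

Lemma semibounded_upper (X : boundedOp H) : semibounded A X ->
  semibounded AA (block_op zero_op X zero_op zero_op).
Proof.
move=> [c c0 hc]; exists c => // x; rewrite !normA_diag /= !add0r normA0.
rewrite expr0n /= addr0 sqrtr_sqr ger0_norm ?sqrtr_ge0// (le_trans (hc _))//.
rewrite ler_wpM2l ?(ltW c0)// -[leLHS]ger0_norm ?sqrtr_ge0// -sqrtr_sqr.
by rewrite ler_wsqrtr// lerDr exprn_ge0// sqrtr_ge0.
Qed.

Lemma semibounded_lower (X : boundedOp H) : semibounded A X ->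
  semibounded AA (block_op zero_op zero_op X zero_op).
Proof.
move=> [c c0 hc]; exists c => // x; rewrite !normA_diag /= !addr0 normA0.
rewrite expr0n /= add0r sqrtr_sqr ger0_norm ?sqrtr_ge0// (le_trans (hc _))//.
rewrite ler_wpM2l ?(ltW c0)// -[leLHS]ger0_norm ?sqrtr_ge0// -sqrtr_sqr.
by rewrite ler_wsqrtr// lerDl exprn_ge0// sqrtr_ge0.
Qed.

End DiagOp.

(* Main.v *)
(** The swap of the two summands exchanges the two block operators.  For the
    lower one the quadratic form at [x = (x1, x2)] is [<X x1, x2>_A], at most
    [|X|_A |x1|_A |x2|_A <= |X|_A (|x1|_A^2 + |x2|_A^2) / 2] by Cauchy-Schwarz.
    Conversely, a unit vector [x] with [|X x|_A != 0] gives the unit vector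
    [(x, X x / |X x|_A) / sqrt 2], at which the form equals [|X x|_A / 2].
    Without vectors of seminorm 1 all the suprema are [sup set0 = 0]. *)

Require Import Defs.
From mathcomp Require Import all_boot all_order all_algebra.
From mathcomp Require Import reals.
From mathcomp Require Import sesquilinear complex ring lra.
From mathcomp Require Import boolp classical_sets.
Set Implicit Arguments.
Unset Strict Implicit.
Unset Printing Implicit Defensive.
Import Order.TTheory GRing.Theory Num.Theory.
Local Open Scope classical_set_scope.
Local Open Scope ring_scope.

Lemma Re_norm_ge0 (R : rcfType) (z : R[i]) : 0 <= complex.Re `|z|.
Proof. by have := normr_ge0 z; rewrite lecE => /andP[]. Qed.

Section SemiInnerProduct.
Context {R : realType} {H : hilbertType R} (A : boundedOp H).
Implicit Types (x y : H) (a : R[i]).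

Local Notation q x := (innerA A x x).

Lemma innerADl x y z : innerA A (x + y) z = innerA A x z + innerA A y z.
Proof. by rewrite /innerA linearD linearDl. Qed.

Lemma innerADr x y z : innerA A x (y + z) = innerA A x y + innerA A x z.
Proof. by rewrite /innerA linearDr. Qed.

Lemma innerAZl a x y : innerA A (a *: x) y = a * innerA A x y.
Proof. by rewrite /innerA linearZ linearZl_LR. Qed.

Lemma innerAZr a x y : innerA A x (a *: y) = a^* * innerA A x y.
Proof. by rewrite /innerA linearZr_LR. Qed.

Context (A_pos : positive_op A).

Lemma normA_ge0 x : 0 <= normA A x.
Proof. exact: sqrtr_ge0. Qed.

(** Positivity makes the form real on the diagonal, so the real part in [normA] discards nothing,
    and seminorm identities can be checked in [R[i]] after squaring. *)
Lemma sqr_normA x : ((normA A x ^+ 2)%:C)%C = q x.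
Proof.
have := A_pos x; rewrite -/(innerA A x x) /normA.
case: (q x) => a b; rewrite lecE /= => /andP[/eqP -> a0].
by rewrite sqr_sqrtr.
Qed.

Lemma normAZ a x : normA A (a *: x) = complex.Re `|a| * normA A x.
Proof.
have n0 : 0 <= complex.Re `|a| by exact: Re_norm_ge0.
apply/eqP; rewrite -(@eqrXn2 _ 2) ?nnegrE ?mulr_ge0 ?normA_ge0//; apply/eqP.
apply: (@complexI R); rewrite sqr_normA exprMn rmorphM /= sqr_normA innerAZl.
by rewrite innerAZr mulrA -normCK rmorphXn /=; congr (_ ^+ 2 * _).
Qed.

(* Polarization: [q (x + y)] and [q (x + i y)] are real. *)
Lemma innerA_conj x y : (innerA A x y)^* = innerA A y x.
Proof.
have qr z : (q z)^* = q z by apply/CrealP/ger0_real/A_pos.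
have := qr (x + y); have := qr (x + 'i *: y).
rewrite !(innerADl, innerADr, innerAZl, innerAZr) !rmorphD !rmorphM /=.
rewrite !qr !conjCK conjCi.
move=> /eqP; rewrite -subr_eq0 => /eqP e1 /eqP; rewrite -subr_eq0 => /eqP e2.
have i2 : 'i * 'i = -1 :> R[i] by rewrite -expr2 sqrCi.
have n2 : 2 != 0 :> R[i] by rewrite pnatr_eq0.
apply: (mulfI n2); apply/eqP; rewrite -subr_eq0; apply/eqP.
(* In [- 'i] times [e1] plus [e2] the unwanted terms cancel, and twice the claimed difference
   remains. *)
rewrite -[RHS](addr0 0) -{1}(mulr0 (- 'i)) -{1}e1 -e2.
ring: i2.
Qed.

(** Cauchy-Schwarz for a possibly degenerate form, by the discriminant of a nonnegative real
    quadratic. The factor [z] in [x + t z y] aligns the phase, so that the linear coefficient is the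
    real number [2 |z|^2]. *)
Lemma Re_norm_innerA_le x y :
  complex.Re `|innerA A x y| <= normA A x * normA A y.
Proof.
set z := innerA A x y; set m := complex.Re `|z|.
have m0 : 0 <= m by exact: Re_norm_ge0.
have mE : (m%:C)%C = `|z| by rewrite RRe_real// normr_real.
have [k kE zz] : exists2 k, k = m ^+ 2 & z * z^* = (k%:C)%C.
  by exists (m ^+ 2); rewrite // rmorphXn /= mE normCK.
(* [p.[t]] is the value of the form at [x + t z y]. *)
pose p : {poly R} :=
  Poly [:: normA A x ^+ 2; 2 * k; k * normA A y ^+ 2].
have p_ge0 t : 0 <= p.[t].
  have := A_pos (x + ((t%:C)%C * z) *: y); rewrite -/(innerA _ _ _).
  rewrite !(innerADl, innerADr, innerAZl, innerAZr) -(innerA_conj x y) -/z.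
  have -> : ((t%:C)%C * z)^* = (t%:C)%C * z^*.
    by rewrite rmorphM/= conj_Creal//; apply/complex_realP; exists t.
  suff -> : innerA A x x + (t%:C)%C * z^* * z + ((t%:C)%C * z * z^* +
      (t%:C)%C * z * ((t%:C)%C * z^* * innerA A y y)) = ((p.[t])%:C)%C.
    by rewrite ler0c.
  rewrite horner_Poly /= -!sqr_normA mul0r add0r.
  by rewrite !(rmorphD, rmorphM) /= -zz; ring.
have p3 : (size p <= 3)%N by exact: size_Poly.
(* The discriminant gives [4 k^2 <= 4 k |x|_A^2 |y|_A^2], even if the leading coefficient vanishes;
   cancelling [k] requires [m != 0]. *)
have := deg_le2_poly_ge0 p3 p_ge0; rewrite !coef_Poly /= => d.
have [->|mN0] := eqVneq m 0; first by rewrite mulr_ge0 ?normA_ge0.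
rewrite -(@ler_pXn2r _ 2) ?nnegrE ?mulr_ge0 ?normA_ge0// exprMn.
have k0 : 0 < k by rewrite kE exprn_gt0// lt_def mN0.
rewrite -kE -(ler_pM2l k0); lra.
Qed.

Lemma normA_unit x : normA A x != 0 ->
  normA A ((((normA A x)^-1)%:C)%C *: x) = 1.
Proof.
move=> x0; rewrite normAZ ger0_norm ?ler0c ?invr_ge0 ?normA_ge0//=.
by rewrite mulVf.
Qed.

Lemma opnormA_has_ubound (X : boundedOp H) : semibounded A X ->
  has_ubound [set normA A (X x) | x in [set x : H | normA A x = 1]].
Proof.
move=> [c _ hc]; exists c => _ [x /= x1 <-].
by rewrite (le_trans (hc x))// x1 mulr1.
Qed.

Lemma normA_op_le (X : boundedOp H) x : semibounded A X ->
  normA A (X x) <= opnormA A X * normA A x.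
Proof.
move=> Xs; have [x0|x0] := eqVneq (normA A x) 0.
  (* A vector of seminorm 0 cannot be normalized, but semiboundedness sends it to a vector of
     seminorm 0. *)
  by have [c _ /(_ x)] := Xs; rewrite x0 !mulr0.
rewrite -ler_pdivrMr ?lt_def ?x0 ?normA_ge0//.
apply: (ub_le_sup (opnormA_has_ubound Xs)).
exists ((((normA A x)^-1)%:C)%C *: x); first exact: normA_unit.
rewrite linearZ normAZ ger0_norm ?ler0c ?invr_ge0 ?normA_ge0//=.
by rewrite mulrC.
Qed.

End SemiInnerProduct.

Section OffDiagonal.
Context {R : realType} {H : hilbertType R} (A X : boundedOp H).
Local Notation AA := (block_op A zero_op zero_op A).

Lemma innerA_upper (x : hsum H) :
  innerA AA (block_op zero_op X zero_op zero_op x) x = innerA A (X x.2) x.1.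
Proof. by rewrite innerA_diag /= !add0r /innerA linear0 linear0l addr0. Qed.

Lemma innerA_lower (x : hsum H) :
  innerA AA (block_op zero_op zero_op X zero_op x) x = innerA A (X x.1) x.2.
Proof. by rewrite innerA_diag /= !addr0 /innerA linear0 linear0l add0r. Qed.

Context (A_pos : positive_op A).

Lemma numradA_upper_lower :
  numradA AA (block_op zero_op X zero_op zero_op)
    = numradA AA (block_op zero_op zero_op X zero_op).
Proof.
congr sup; apply/seteqP; split=> _ [x /= x1 <-]; exists ((x.2, x.1) : hsum H);
  by rewrite ?innerA_upper ?innerA_lower//= -x1 !normA_diag//= addrC.
Qed.

Lemma numradA_lower (X_semibounded : semibounded A X) :
  numradA AA (block_op zero_op zero_op X zero_op) = 2^-1 * opnormA A X.
Proof.
set S := [set complex.Re `|innerA AA (block_op zero_op zero_op X zero_op x) x|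
  | x in [set x : hsum H | normA AA x = 1]].
have [[x0 x01]|noA1] := pselect (exists x, normA A x = 1); last first.
  rewrite /numradA /opnormA.
  (* Any vector of nonzero seminorm could be rescaled to a unit vector, so the seminorm vanishes on
     [H], hence also on the sum. *)
  have n0 x : normA A x = 0.
    apply/eqP/negPn/negP => /(normA_unit A_pos) x1.
    by apply: noA1; eexists; exact: x1.
  rewrite [X in sup X](_ : _ = set0) ?[X in _ * sup X](_ : _ = set0).
  - by rewrite sup0 mulr0.
  - by apply/seteqP; split=> // _ [x /= x1 _]; apply: noA1; exists x.
  - apply/seteqP; split=> // _ [x /= + _].
    rewrite normA_diag// !n0 expr0n addr0 sqrtr0 => /esym/eqP.
    by rewrite oner_eq0.
have M0 : 0 <= opnormA A X.
  have := normA_op_le A_pos x0 X_semibounded.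
  by rewrite x01 mulr1; apply: le_trans; exact: normA_ge0.
have S_le : ubound S (2^-1 * opnormA A X).
  move=> _ [x /= x1 <-]; rewrite innerA_lower.
  rewrite (le_trans (Re_norm_innerA_le A_pos _ _))//.
  have := normA_op_le A_pos x.1 X_semibounded.
  have : normA A x.1 ^+ 2 + normA A x.2 ^+ 2 = 1.
    have := congr1 (fun r => r ^+ 2) x1.
    by rewrite normA_diag// sqr_sqrtr ?expr1n// addr_ge0 ?sqr_ge0.
  move: M0 (normA_ge0 A x.1) (normA_ge0 A x.2).
  move: (opnormA _ _) (normA A x.1) (normA A x.2) (normA A (X _)).
  move=> M a b n M0 a0 b0 ab nM.
  apply: le_trans (ler_wpM2r b0 nM) _.
  (* With [a^2 + b^2 = 1] this gives [a b <= 1/2], to be multiplied by [M >= 0]. *)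
  have := sqr_ge0 (a - b); nra.
have S_ub : has_ubound S by exists (2^-1 * opnormA A X).
(* These unit vectors show that [S] is nonempty, and they serve below when [n = 0], where the main
   witness would divide by zero. *)
have xS (x : H) : normA A x = 1 -> normA AA ((x, 0) : hsum H) = 1.
  by move=> x1; rewrite normA_diag//= x1 normA0 expr1n expr0n addr0 sqrtr1.
apply/eqP; rewrite eq_le; apply/andP; split.
  apply: ge_sup => //.
  by eexists; exists ((x0, 0) : hsum H); first exact: xS.
rewrite -ler_pdivlMl ?invr_gt0// invrK.
apply: ge_sup; first by exists (normA A (X x0)); exists x0.
move=> _ [x /= x1 <-].
rewrite -ler_pdivrMl//.
set n := normA A (X x); have [n0|n0] := eqVneq n 0.
  rewrite n0 mulr0; apply: le_trans (ub_le_sup S_ub _); last first.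
    by exists ((x, 0) : hsum H); first exact: xS.
  exact: Re_norm_ge0.
apply: (ub_le_sup S_ub).
pose r : R := (Num.sqrt 2)^-1.
have r0 : 0 <= r by rewrite invr_ge0 sqrtr_ge0.
have rr : r ^+ 2 = 2^-1 by rewrite exprVn sqr_sqrtr.
have rn0 : 0 <= r / n by rewrite divr_ge0 ?normA_ge0.
(* Both components have seminorm [r], so the squares add up to 1; the form takes the value
   [r (r / n) n^2 = n / 2]. *)
exists (((r%:C)%C *: x, ((r / n)%:C)%C *: X x) : hsum H).
  rewrite /= normA_diag//= !normAZ// !ger0_norm ?ler0c//= x1 mulr1 -/n divfK//.
  by rewrite rr -[2^-1]mul1r -splitr sqrtr1.
rewrite innerA_lower; cbn [fst snd].
suff -> : innerA A (X ((r%:C)%C *: x)) (((r / n)%:C)%C *: X x)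
    = ((2^-1 * n)%:C)%C.
  by rewrite ger0_norm ?ler0c ?mulr_ge0 ?invr_ge0 ?normA_ge0.
rewrite linearZ innerAZl innerAZr -sqr_normA// -/n.
rewrite conj_Creal; last by apply/complex_realP; eexists.
rewrite -!rmorphM; congr (_%:C)%C.
by rewrite -rr; field.
Qed.

End OffDiagonal.

Theorem corollary2p6 (R : realType) (H : hilbertType R) (A X : boundedOp H)
    (A_pos : positive_op A) (X_semibounded : semibounded A X) :
  let AA : boundedOp (hsum H) := block_op A zero_op zero_op A in
  numradA AA (block_op zero_op X zero_op zero_op)
    = numradA AA (block_op zero_op zero_op X zero_op)
  /\ numradA AA (block_op zero_op zero_op X zero_op) = 2^-1 * opnormA A X.
Proof. by split; [exact: numradA_upper_lower|exact: numradA_lower]. Qed.
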